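(* Let $Y$ be a non-reflexive Banach space over $\mathbb{K}$ and let $X=\mathbb{K}\oplus_\infty Y$. Then the pair $(X,X)$ does not have the Compact Perturbation Property for the minimum modulus (CPPm). That is, it is not the case that every bounded linear operator $T:X\to X$ which does not attain its minimum modulus satisfies $\sup_{K\in\mathcal{K}(X,X)} m(T+K)=m(T)$.
   Context: Scalars are $\mathbb{K}=\mathbb{R}$ or $\mathbb{C}$. $\mathbb{K}\oplus_\infty Y$ denotes the direct sum $\mathbb{K}\times Y$ with the norm $\|(a,y)\|=\max\{|a|,\|y\|\}$. For Banach spaces $X,Z$ over $\mathbb{K}$, $L(X,Z)$ denotes the space of bounded linear operators from $X$ to $Z$, $\mathcal{K}(X,Z)$ the space of compact linear operators from $X$ to $Z$, and $S_X=\{x\in X:\|x\|=1\}$ the unit sphere of $X$. The minimum modulus of $T\in L(X,Z)$ is $m(T)=\inf\{\|Tx\|:x\in S_X\}$. The operator $T$ attains its minimum modulus if there is $x\in S_X$ with $\|Tx\|=m(T)$. The pair $(X,Z)$ has the Compact Perturbation Property for the minimum modulus (CPPm) if for every $T\in L(X,Z)$ that does not attain its minimum modulus one has $\sup_{K\in\mathcal{K}(X,Z)} m(T+K)=m(T)$. *)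

(* Defs.v *)
From HB Require Import structures.
From mathcomp Require Import all_boot all_order all_algebra.
From mathcomp Require Import all_classical all_reals.
From mathcomp Require Import topology normedtype.
From mathcomp Require Import complex.

Set Implicit Arguments.
Unset Strict Implicit.
Unset Printing Implicit Defensive.

Import Order.TTheory GRing.Theory Num.Theory.
Import numFieldNormedType.Exports.

Local Open Scope classical_set_scope.
Local Open Scope ring_scope.

(* The definitions are over an arbitrary numFieldType K and are meant for K := R
   and K := R[i] with R : realType. Norms take their values in K. In R[i], z <= w
   means that w - z is a nonnegative real, so the infimum and the supremum of a
   nonempty set of reals are the same in R[i] as in R: *)

Section ComplexBounds.
Context {R : realType}.
Local Open Scope complex_scope.
Implicit Type A : set R.

Lemma supremums_complex A m : A !=set0 ->
  supremums [set x%:C | x in A] m%:C = supremums A m.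
Proof.
move=> [a0 Aa0]; apply/propext; split=> -[ub lub]; split.
- by move=> x Ax; rewrite -lecR; apply: ub; exists x.
- move=> u uA; rewrite -lecR; apply: lub => _ [x Ax <-].
  by rewrite lecR; apply: uA.
- by move=> _ [x Ax <-]; rewrite lecR; apply: ub.
- move=> u uA.
  have : a0%:C <= u by apply: uA; exists a0.
  case: u uA => u v uA; rewrite lecE /= => /andP[/eqP v0 _].
  rewrite lecE /= v0 eqxx /=; apply: lub => x Ax.
  have : x%:C <= (u +i* v) by apply: uA; exists x.
  by rewrite lecE /= => /andP[].
Qed.

Lemma infimums_complex A m : A !=set0 ->
  infimums [set x%:C | x in A] m%:C = infimums A m.
Proof.
move=> [a0 Aa0]; apply/propext; split=> -[ub lub]; split.
- by move=> x Ax; rewrite -lecR; apply: ub; exists x.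
- move=> u uA; rewrite -lecR; apply: lub => _ [x Ax <-].
  by rewrite lecR; apply: uA.
- by move=> _ [x Ax <-]; rewrite lecR; apply: ub.
- move=> u uA.
  have : u <= a0%:C by apply: uA; exists a0.
  case: u uA => u v uA; rewrite lecE /= => /andP[/eqP v0 _].
  rewrite lecE /= -v0 eqxx /=; apply: lub => x Ax.
  have : (u +i* v) <= x%:C by apply: uA; exists x.
  by rewrite lecE /= => /andP[].
Qed.
End ComplexBounds.

Section Operators.
Context {K : numFieldType} {V W : normedModType K}.
Implicit Type T : V -> W.

Definition unit_ball : set V := [set x | `|x| <= 1].

Definition unit_sphere : set V := [set x | `|x| = 1].

Definition bounded_operator : set (V -> W) :=
  [set T | linear T /\ exists C : K, forall x, `|T x| <= C * `|x|].

Definition compact_operator : set (V -> W) :=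
  [set T | linear T /\ precompact (T @` unit_ball)].

Definition operator_norm T : K := supremum 0 [set `|T x| | x in unit_ball].

Definition min_modulus T : K := infimum 0 [set `|T x| | x in unit_sphere].

Definition attains_min_modulus T : Prop :=
  exists2 x, unit_sphere x & `|T x| = min_modulus T.

End Operators.

Section Spaces.
Context {K : numFieldType}.
Implicit Types V W : normedModType K.

Definition dual V : set (V -> K^o) := @bounded_operator K V K^o.

(* An element of the bidual is represented by a function on all of V -> K^o;
   only its values on the dual space are constrained or used. *)
Definition bidual V : set ((V -> K^o) -> K) :=
  [set phi |
    (forall (a : K) f g, dual f -> dual g ->
       phi (a \*: f \+ g) = a * phi f + phi g) /\
    (exists C : K, forall f, dual f -> `|phi f| <= C * operator_norm f)].

(* surjectivity of the canonical embedding into the bidual *)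
Definition reflexive_space V : Prop :=
  forall phi, @bidual V phi -> exists x : V, forall f, dual f -> phi f = f x.

(* [supremums A m] says that the supremum of A exists and equals m; nothing is
   hidden in a default value when A is unbounded. *)
Definition CPPm V W : Prop :=
  forall T : V -> W, bounded_operator T -> ~ attains_min_modulus T ->
    supremums [set min_modulus (T \+ S) | S in compact_operator]
              (min_modulus T).

(* The library norm on a product is the maximum norm. *)
Definition scalar_sum V : normedModType K := (K^o * V)%type.

Lemma scalar_sum_normE V (a : K) (y : V) :
  `|(a, y) : scalar_sum V| = Num.max `|a| `|y|.
Proof. by []. Qed.

End Spaces.

(* Main.v *)
(* By James' theorem a non-reflexive Y carries a functional g that does not
   attain its norm s on the unit ball. Then T(a, y) = (a - g y, y), whose
   inverse (a, y) |-> (a + g y, y) has norm 1 + s without attaining it, does not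
   attain its minimum modulus 1 / (1 + s), while adding the rank-one operator
   (a, y) |-> (g y, 0) to T gives the identity, of minimum modulus 1.

   James' theorem is proved for a real norm (complex functionals are determined
   by their real parts). Non-reflexivity and the Hahn-Banach theorem yield
   functionals f_0, f_1, ... in the dual ball such that every convex mixture h
   of them satisfies h - f_n >= theta > 0, for large n, at some point of the unit
   ball. A diagonal argument (Pryce) makes the supremum over the ball of
   limsup (h - f_n) equal to that of liminf (h - f_n) for the countably many
   mixtures h. Mixtures g_n of the tails of (f_n)
   are then chosen one after the other, g_n nearly minimizing the first of these
   suprema for h = \sum_(i < n) (1 - q) q^i g_i + q^n g_n, as in Simons'
   inequality. If F = \sum_i (1 - q) q^i g_i - w, where w is a generalized limit
   of (g_n), attained its supremum at x, then g_n x - w x would be bounded below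
   by a positive constant, which is absurd. *)
From HB Require Import structures.
Require Import Defs.
From mathcomp Require Import all_boot all_order all_algebra.
From mathcomp Require Import all_classical all_reals interval_inference.
From mathcomp Require Import topology normedtype sequences complex.
From mathcomp Require Import ring lra.

Import Order.TTheory GRing.Theory Num.Theory.
Import numFieldNormedType.Exports.
Set Implicit Arguments.
Unset Strict Implicit.
Unset Printing Implicit Defensive.
Local Open Scope classical_set_scope.
Local Open Scope ring_scope.
Local Open Scope complex_scope.

(** * Subsequences and generalized limits *)

Lemma frequently_subseq (P : nat -> Prop) :
  (forall N, exists n, (N <= n)%N /\ P n) ->
  exists r : nat -> nat, {homo r : m n / (m < n)%N} /\ forall n, P (r n).
Proof.
move=> /choice [nx nxP].
pose r := fix r n := if n is n'.+1 then nx (r n').+1 else nx 0%N.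
exists r; split; last by case=> [|n]; [exact: (nxP _).2|exact: (nxP _).2].
by apply: homo_ltn => [???|n]; [exact: ltn_trans|exact: (nxP _).1].
Qed.

Lemma increasing_geq_id (r : nat -> nat) :
  {homo r : m n / (m < n)%N} -> forall n, (n <= r n)%N.
Proof. by move=> rS; elim=> // n IH; exact: leq_ltn_trans IH (rS _ _ _). Qed.

(** Stage [k] treats the index with code [k]: if some [x] satisfies [Q] infinitely often along the
    current sequence, pass to a subsequence on which it always does. Both outcomes recorded by
    [settled] survive further extraction, so the diagonal sequence inherits them. *)
Lemma diagonal_subseq (I : countType) (X : Type) (Q : I -> X -> nat -> Prop) :
  exists s : nat -> nat, {homo s : m n / (m < n)%N} /\
    forall i, (exists x, forall N, exists n, (N <= n)%N /\ Q i x (s n)) ->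
      exists y, exists N, forall n, (N <= n)%N -> Q i y (s n).
Proof.
pose settled i s := (exists y, forall n, Q i y (s n)) \/
  forall x, exists N, forall n, (N <= n)%N -> ~ Q i x (s n).
have step (a : nat * (nat -> nat)) : exists r : nat -> nat,
    {homo r : m n / (m < n)%N} /\
    forall i, unpickle a.1 = Some i -> settled i (a.2 \o r).
  case: a => k s /=; case E: (unpickle k) => [i|]; last first.
    by exists id; split=> // i [].
  have [[x xP]|nx] := pselect
      (exists x, forall N, exists n, (N <= n)%N /\ Q i x (s n)).
    have [r [rS rP]] := frequently_subseq xP.
    by exists r; split=> // _ [<-]; left; exists x.
  exists id; split=> // _ [<-]; right=> x; apply: contrapT => H; apply: nx.
  exists x => N; apply: contrapT => H'; apply: H; exists N => n Nn Qn.
  by apply: H'; exists n.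
have [next nextP] := choice step.
pose S := fix S k := if k is k'.+1 then S k' \o next (k', S k') else id.
have S_homo k : {homo S k : m n / (m < n)%N}.
  elim: k => // k IH m n mn; apply: IH.
  by apply: (nextP _).1.
have S_sub k d : exists2 r : nat -> nat, {homo r : m n / (m < n)%N} &
    S (k + d)%N = S k \o r.
  elim: d => [|d [r rS rE]]; first by exists id; rewrite ?addn0.
  exists (r \o next ((k + d)%N, S (k + d)%N)).
    by move=> m n mn; apply: rS; apply: (nextP _).1.
  by rewrite addnS /= {1}rE.
exists (fun n => S n n); split.
  apply: homo_ltn => [???|n]; first exact: ltn_trans.
  by apply: S_homo; apply: increasing_geq_id (nextP _).1 n.+1.
move=> i [x xP].
have [[y yP]|] := (nextP (pickle i, S (pickle i))).2 i (pickleK i).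
  exists y, (pickle i).+1 => n /subnKC <-.
  by have [r _ ->] := S_sub (pickle i).+1 (n - (pickle i).+1)%N; exact: yP.
move=> /(_ x) [N NP]; exfalso.
have [n [nN]] := xP (maxn N (pickle i).+1).
move: nN; rewrite geq_max => /andP[Nn /subnKC].
have [r rS E] := S_sub (pickle i).+1 (n - (pickle i).+1)%N.
move=> nE; rewrite -{1}nE E; apply: NP.
by apply: leq_trans Nn _; apply: increasing_geq_id.
Qed.

(** The limit along an ultrafilter finer than [\oo]: a bounded sequence stays in a compact segment,
    hence converges along it. *)
Lemma banach_limit (R : realType) : exists L : (nat -> R) -> R,
  [/\ forall (a : R) (u v : nat -> R), (exists b : R, forall n, `|u n| <= b) ->
        (exists b : R, forall n, `|v n| <= b) ->
        L (fun n => a * u n + v n) = a * L u + L v,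
      forall (u : nat -> R) c, (exists b : R, forall n, `|u n| <= b) ->
        (\forall n \near \oo, c <= u n) -> c <= L u
    & forall (u : nat -> R) c, (exists b : R, forall n, `|u n| <= b) ->
        (\forall n \near \oo, u n <= c) -> L u <= c].
Proof.
have [U [UU sU]] := @ultraFilterLemma _ (\oo : set_system nat) _.
have PU : ProperFilter U := @ultra_proper _ U UU.
have cv (u : nat -> R) : (exists b : R, forall n, `|u n| <= b) ->
    cvg (u x @[x --> U]).
  move=> [b ub].
  have [p [_ pu]] : `[- b, b] `&` cluster (u x @[x --> U]) !=set0.
    apply: segment_compact; change (U [set n | u n \in `[- b, b]]);
      apply: filterE => n /=.
by rewrite in_itv /= -ler_norml.
  apply/cvg_ex; exists p => V Vp.
  have [//|nV] := in_ultra_setVsetC (u @^-1` V) UU.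
  by have [y [? ?]] := pu (~` V) V nV Vp.
exists (fun u => lim (u x @[x --> U]));
  split=> [a u v bu bv|u c bu uc|u c bu uc].
  apply: cvg_lim => //; apply: cvgD; last exact: cv.
  by apply: cvgMl_tmp; exact: cv.
  by apply: limr_ge; [exact: cv|exact: sU].
by apply: limr_le; [exact: cv|exact: sU].
Qed.

(** * Convex mixtures and Simons' construction *)

(** Formal iterated convex combinations; [mix] weighs the children of a node by [1 - q] and [q].
    Being countably many, they can all be handled by one diagonal subsequence. *)
Inductive tree := Leaf of nat | Node of tree & tree.

Fixpoint tree_code t : GenTree.tree nat :=
  match t with
  | Leaf n => GenTree.Leaf n
  | Node t u => GenTree.Node 0 [:: tree_code t; tree_code u]
  end.

Fixpoint tree_decode (c : GenTree.tree nat) : option tree :=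
  match c with
  | GenTree.Leaf n => Some (Leaf n)
  | GenTree.Node _ [:: c1; c2] =>
      if tree_decode c1 is Some t then
        if tree_decode c2 is Some u then Some (Node t u) else None
      else None
  | _ => None
  end.

Lemma tree_codeK : pcancel tree_code tree_decode.
Proof. by elim=> //= t -> u ->. Qed.

HB.instance Definition _ := Countable.copy tree (pcan_type tree_codeK).

Fixpoint relabel (s : nat -> nat) t :=
  match t with
  | Leaf n => Leaf (s n)
  | Node t u => Node (relabel s t) (relabel s u)
  end.

Fixpoint leaves_from n t :=
  match t with
  | Leaf k => (n <= k)%N
  | Node t u => leaves_from n t && leaves_from n u
  end.

Lemma leaves_from_le m n t : (m <= n)%N -> leaves_from n t -> leaves_from m t.
Proof.
move=> mn; elim: t => [k|t IHt u IHu] /=; first exact: leq_trans.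
by move=> /andP[/IHt -> /IHu].
Qed.

Section Mixtures.
Context {R : realType} {T : Type} (q : R).
Implicit Types (f : nat -> T -> R) (t : tree) (B : set T).

Fixpoint mix f t x : R :=
  match t with
  | Leaf n => f n x
  | Node t u => (1 - q) * mix f t x + q * mix f u x
  end.

Lemma mix_relabel f s t x : mix f (relabel s t) x = mix (f \o s) t x.
Proof. by elim: t => //= t -> u ->. Qed.

(** Linearity is phrased through one relation between three points because [T] is a bare type. *)
Lemma mix_affine f t a x y z :
  (forall n, f n z = a * f n x + f n y) -> mix f t z = a * mix f t x + mix f t y.
Proof. by move=> fz; elim: t => //= t -> u ->; ring. Qed.

Hypothesis q01 : 0 <= q <= 1.

Lemma mix_le f n t x c : leaves_from n t ->
  (forall k, (n <= k)%N -> f k x <= c) -> mix f t x <= c.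
Proof.
move=> nt fc; elim: t nt => [k|t IHt u IHu] /=; first exact: fc.
by case/andP: q01 => ? ? /andP[/IHt tc /IHu uc]; nra.
Qed.

Lemma mix_ge f n t x c : leaves_from n t ->
  (forall k, (n <= k)%N -> c <= f k x) -> c <= mix f t x.
Proof.
move=> nt fc; elim: t nt => [k|t IHt u IHu] /=; first exact: fc.
by case/andP: q01 => ? ? /andP[/IHt tc /IHu uc]; nra.
Qed.

Lemma leaves_from0 t : leaves_from 0 t.
Proof. by elim: t => //= t -> u ->. Qed.

Lemma mix_norm_le f t x b : (forall n, `|f n x| <= b) -> `|mix f t x| <= b.
Proof.
move=> fb; rewrite ler_norml.
rewrite (mix_ge (leaves_from0 t)) ?(mix_le (leaves_from0 t)) // => k _.
  by have := fb k; rewrite ler_norml => /andP[].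
by have := fb k; rewrite ler_norml => /andP[].
Qed.

End Mixtures.

(** * A functional without a maximum on [B], by Simons' construction *)

Section Core.
Context {R : realType} {T : Type} (q theta : R) (B : set T).
Context (f : nat -> T -> R).
Hypotheses (q0 : 0 < q) (q1 : q < 1) (qtheta : 3 * q < theta).
Hypothesis B0 : B !=set0.
Hypothesis f_bounded : forall x, exists b, forall n, `|f n x| <= b.
Hypothesis f_le1 : forall x, B x -> forall n, `|f n x| <= 1.
(* [sup_B limsup (h - f n) <= sup_B liminf (h - f n)] for every mixture [h]. *)
Hypothesis f_stable : forall t x c, B x ->
  ~ (\forall n \near \oo, mix q f t x - f n x <= c) ->
  forall c', c' < c -> exists2 y, B y & \forall n \near \oo, c' <= mix q f t y - f n y.
Hypothesis f_separated : forall t,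
  exists2 y, B y & \forall n \near \oo, theta <= mix q f t y - f n y.

Let q01 : 0 <= q <= 1. Proof. by rewrite !ltW. Qed.

(** The infimum of [good] is the infimum, over mixtures of the tail from [n], of the supremum over
    [B] of the limsup in [k]. It is finite because all values on [B] are bounded by [b + 2], so some
    member lies within [e] of it. *)
Lemma near_minimal_mixture (n : nat) (G : T -> R) (e : R) :
  0 < e -> (exists b, forall x, B x -> `|G x| <= b) ->
  exists tc : tree * R,
  [/\ leaves_from n tc.1,
      forall x, B x ->
        \forall k \near \oo, G x + q ^+ n * mix q f tc.1 x - f k x <= tc.2
    & forall t c, leaves_from n t ->
        (forall x, B x ->
           \forall k \near \oo, G x + q ^+ n * mix q f t x - f k x <= c) ->
        tc.2 <= c + e].
Proof.
move=> e0 [b Gb].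
pose good := [set c | exists2 t, leaves_from n t & forall x, B x ->
  \forall k \near \oo, G x + q ^+ n * mix q f t x - f k x <= c].
have qn : 0 <= q ^+ n <= 1.
  by rewrite exprn_ge0 ?exprn_ile1 // ltW.
have bnd x t k : B x -> `|G x + q ^+ n * mix q f t x - f k x| <= b + 2.
  move=> Bx; have := f_le1 Bx k; have := mix_norm_le q01 t (f_le1 Bx).
  have := Gb x Bx; rewrite !ler_norml.
  case/andP: qn => ? ? /andP[? ?] /andP[? ?] /andP[? ?].
  by apply/andP; split; nra.
have has_inf_good : has_inf good.
  split.
    exists (b + 2), (Leaf n) => //= x Bx; near=> k.
    exact: le_trans (ler_norm _) (bnd x (Leaf n) k Bx).
  have [x Bx] := B0; exists (- (b + 2)) => c [t _ /(_ x Bx)].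
  move=> /(@filter_ex _ _ _) [k]; apply: le_trans.
  by have := bnd x t k Bx; rewrite ler_norml => /andP[].
have [c [t nt tc] ce] := inf_adherent e0 has_inf_good.
exists (t, c); split=> //= t' c' nt' tc'.
apply: le_trans (ltW ce) _; rewrite lerD2r; apply: ge_inf;
  first exact: has_inf_good.2.
by exists t'.
Unshelve. all: by end_near.
Qed.

Lemma sup_not_attained : exists F : T -> R,
  [/\ forall a x y z, (forall n, f n z = a * f n x + f n y) ->
        F z = a * F x + F y,
      forall x b, (forall n, `|f n x| <= b) -> `|F x| <= 2 * b
    & forall x, B x -> exists2 y, B y & F x < F y].
Proof.
(* Boundedness of the partial sum is a premise inside the choice, since it is only established once
   the sums are defined. The tolerance [(q ^+ n.+1) ^+ 2] is tuned to the induction in [G_a]. *)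
have step (nG : nat * (T -> R)) : exists tc : tree * R,
    (exists b, forall x, B x -> `|nG.2 x| <= b) ->
    [/\ leaves_from nG.1 tc.1,
        forall x, B x -> \forall k \near \oo,
          nG.2 x + q ^+ nG.1 * mix q f tc.1 x - f k x <= tc.2
      & forall t c, leaves_from nG.1 t ->
          (forall x, B x -> \forall k \near \oo,
             nG.2 x + q ^+ nG.1 * mix q f t x - f k x <= c) ->
          tc.2 <= c + (q ^+ nG.1.+1) ^+ 2].
  have [bG|nb] := pselect (exists b, forall x, B x -> `|nG.2 x| <= b).
    have e0 : 0 < (q ^+ nG.1.+1) ^+ 2 by rewrite !exprn_gt0.
    by have [tc] := near_minimal_mixture nG.1 e0 bG; exists tc.
  by exists (Leaf 0, 0).
have [pick pickP] := choice step.
(* [G n] is the partial sum of [(1 - q) * q ^+ i * g i] over [i < n]. *)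
pose G := fix G n : T -> R := if n is m.+1 then
  fun x => G m x + (1 - q) * q ^+ m * mix q f (pick (m, G m)).1 x else fun=> 0.
pose t n := (pick (n, G n)).1; pose c n := (pick (n, G n)).2.
pose g n x := mix q f (t n) x; pose H n x := G n x + q ^+ n * g n x.
have GS n x : G n.+1 x = G n x + (1 - q) * q ^+ n * g n x by [].
have g_le n x b : (forall k, `|f k x| <= b) -> `|g n x| <= b.
  by move=> fb; exact: mix_norm_le.
have qn n : 0 < q ^+ n by rewrite exprn_gt0.
have G_diff d n x b : (forall k, `|f k x| <= b) ->
    `|G (n + d)%N x - G n x| <= (q ^+ n - q ^+ (n + d)) * b.
  move=> fb; elim: d => [|d IHd]; first by rewrite addn0 !subrr mul0r normr0.
  rewrite addnS GS exprS; set Q := q ^+ (n + d).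
  have -> : (q ^+ n - q * Q) * b = (q ^+ n - Q) * b + (1 - q) * Q * b by ring.
  rewrite addrAC; apply: le_trans (ler_normD _ _) (lerD IHd _).
  have qQ : 0 <= (1 - q) * Q by rewrite mulr_ge0 ?subr_ge0 ?ltW // qn.
  by rewrite normrM (ger0_norm qQ) ler_wpM2l // g_le.
have G_le n x b : (forall k, `|f k x| <= b) -> `|G n x| <= b.
  move=> fb; have := G_diff n 0%N x b fb; rewrite add0n subr0 expr0.
  move=> /le_trans; apply.
  have b0 : 0 <= b by apply: le_trans (fb 0%N).
  by rewrite ler_piMl // lerBlDr lerDl ltW.
have tcP n : [/\ leaves_from n (t n),
    forall x, B x -> \forall k \near \oo, H n x - f k x <= c n
  & forall t c', leaves_from n t ->
      (forall x, B x -> \forall k \near \oo,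
         G n x + q ^+ n * mix q f t x - f k x <= c') ->
      c n <= c' + (q ^+ n.+1) ^+ 2].
  by apply: pickP; exists 1 => x Bx; apply: G_le; exact: f_le1.
(* Every later [H] is a competitor in the minimization made at stage [i], and for [i = 0] it is
   itself a mixture. *)
have H_tree d i : exists2 u, leaves_from i u &
    forall x, H (i + d)%N x = G i x + q ^+ i * mix q f u x.
  elim: d i => [|d IHd] i.
    by rewrite addn0; exists (t i); [have [] := tcP i|].
  have [u ui uH] := IHd i.+1; have [ti _ _] := tcP i.
  exists (Node (t i) u); first by rewrite /= ti (leaves_from_le (leqnSn i)).
  by move=> x; rewrite addnS -addSn uH GS /= -/(g i x) exprS; ring.
have [L [L_lin L_ge L_le]] := banach_limit R.
have gb x : exists b, forall n, `|g n x| <= b.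
  by have [b fb] := f_bounded x; exists b => n; exact: g_le.
have Gb x : exists b, forall n, `|G n x| <= b.
  by have [b fb] := f_bounded x; exists b => n; exact: G_le.
pose w x := L (g ^~ x); pose h x := L (G ^~ x).
exists (fun x => h x - w x); split.
- move=> a x y z fz.
  have gz : g ^~ z = fun n => a * g n x + g n y.
    by apply/funext => n; exact: mix_affine.
  have Gz : G ^~ z = fun n => a * G n x + G n y.
    apply/funext; elim=> [|n IHn]; first by rewrite /= mulr0 addr0.
    by rewrite !GS IHn (congr1 (fun s => s n) gz); ring.
  by rewrite /h /w gz Gz !L_lin //; ring.
- move=> x b fb.
  have hb : `|h x| <= b.
    rewrite ler_norml; apply/andP; split; [apply: L_ge|apply: L_le] => //.
      by near=> n; have := G_le n _ _ fb; rewrite ler_norml => /andP[].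
    by near=> n; have := G_le n _ _ fb; rewrite ler_norml => /andP[].
  have wb : `|w x| <= b.
    rewrite ler_norml; apply/andP; split; [apply: L_ge|apply: L_le] => //.
      by near=> n; have := g_le n _ _ fb; rewrite ler_norml => /andP[].
    by near=> n; have := g_le n _ _ fb; rewrite ler_norml => /andP[].
  by rewrite mulrDl mul1r; apply: le_trans (ler_normB _ _) (lerD hb wb).
have w_le x : B x -> -1 <= w x.
  move=> Bx; apply: L_ge => //; near=> n.
  by have := g_le n _ _ (f_le1 Bx); rewrite ler_norml => /andP[].
have h_close x n : B x -> `|h x - G n x| <= q ^+ n.
  move=> Bx.
  have Gd m : (n <= m)%N -> `|G m x - G n x| <= q ^+ n.
    move=> /subnKC <-; apply: le_trans (G_diff _ _ _ _ (f_le1 Bx)) _.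
    by rewrite mulr1 lerBlDr lerDl ltW.
  rewrite ler_distl; apply/andP; split; [apply: L_ge|apply: L_le] => //.
    by exists n => // m /= /Gd; rewrite ler_distl => /andP[].
  by exists n => // m /= /Gd; rewrite ler_distl => /andP[].
(* Eventual bounds on [f k x] pass to [g n x], a mixture of the tail from [n], and then to the
   generalized limit [w x]. *)
have w_upper x r k0 : (\forall k \near \oo, r - f k x <= k0) -> r - w x <= k0.
  move=> [N _ Nf]; rewrite lerBlDr -lerBlDl; apply: L_ge => //;
    exists N => // n /= Nn.
  have [tn _ _] := tcP n; apply: (mix_ge q01 tn) => k nk.
  by rewrite lerBlDl -lerBlDr; apply: Nf; exact: leq_trans nk.
have w_lower x r k0 : (\forall k \near \oo, k0 <= r - f k x) -> k0 <= r - w x.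
  move=> [N _ Nf]; rewrite lerBrDr -lerBrDl; apply: L_le => //;
    exists N => // n /= Nn.
  have [tn _ _] := tcP n; apply: (mix_le q01 tn) => k nk.
  by rewrite lerBrDl -lerBrDr; apply: Nf; exact: leq_trans nk.
have H_close x n : B x -> H n x - w x <= h x - w x + 2 * q ^+ n.
  move=> Bx; have := h_close x n Bx; rewrite ler_distl => /andP[+ _].
  have := g_le n _ _ (f_le1 Bx); rewrite ler_norml => /andP[_ +].
  by have := qn n; rewrite /H; nra.
have small e : 0 < e -> exists n0, forall n, (n0 <= n)%N -> 2 * q ^+ n < e.
  move=> e0; have [] := @cvgr0_norm_lt _ _ _ \oo _ (fun n => q ^+ n) _ (e / 2).
  - by apply: cvg_expr; rewrite gtr0_norm.
  - by rewrite divr_gt0.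
  move=> n0 _ nP; exists n0 => n /nP; rewrite gtr0_norm //.
  by rewrite ltr_pdivlMr // mulrC.
move=> x Bx; apply: contrapT => nx; set a := h x - w x.
have ha y : B y -> h y - w y <= a.
  by move=> By; rewrite leNgt; apply/negP => ay; apply: nx; exists y.
(* The mixture [H n] exceeds the [f k] eventually by [theta] at some [y], hence exceeds [w] there;
   and [H n - w] is at most [a + 2 * q ^+ n] on [B]. *)
have theta_a : theta <= a.
  rewrite leNgt; apply/negP;
    rewrite -subr_gt0 => /small [n /(_ n (leqnn n)) na].
  have [u _ uH] := H_tree n 0%N; have [y By yu] := f_separated u.
  have /w_lower : \forall k \near \oo, theta <= H n y - f k y.
    by rewrite (uH y) add0r mul1r.
  by have := H_close y n By; have := ha y By; lra.
(* Let the excess be [4 * r]. For large [d] the competitor [H (i + d)] would have eventual bound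
   [a + 2 * r] on [B]: otherwise [f_stable] gives a point where [H (i + d) - w >= a + r], against
   [H_close]. Near-minimality of [c i] is then violated. *)
have c_a i : c i <= a + (q ^+ i.+1) ^+ 2.
  rewrite leNgt; apply/negP => ai.
  pose r := (c i - a - (q ^+ i.+1) ^+ 2) / 4.
  have r0 : 0 < r by rewrite /r; lra.
  have [n0 n0P] := small r r0; pose d := n0.
  have [_ _ min_i] := tcP i; have [u iu uH] := H_tree d i.
  suff cu y : B y ->
      \forall k \near \oo, G i y + q ^+ i * mix q f u y - f k y <= a + 2 * r.
    by have := min_i u _ iu cu; rewrite /r; lra.
  move=> By; apply: contrapT => nu.
  have [v _ vH] := H_tree (i + d)%N 0%N.
  have Hv z : H (i + d)%N z = mix q f v z by rewrite vH add0r mul1r.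
  have ar : a + r < a + 2 * r by lra.
  rewrite -uH Hv in nu; have [z Bz] := f_stable By nu ar.
  rewrite -Hv => /w_lower; have := H_close z (i + d)%N Bz; have := ha z Bz.
  by have := n0P (i + d)%N (leq_addl _ _); lra.
(* [G n.+1 - (1 - q ^+ n.+1) * w] is the mixture of [H n - w] and
   [G n - (1 - q ^+ n) * w] with weights [1 - q] and [q]. *)
have G_a n : G n x - (1 - q ^+ n) * w x <= (1 - q ^+ n) * (a + q * q ^+ n).
  elim: n => [|n IHn]; first by rewrite /= subrr !mul0r subr0.
  have [_ /(_ x Bx)/w_upper Hc _] := tcP n.
  move: Hc (c_a n) IHn; rewrite GS /H (exprS q n); have := qn n;
    set Q := q ^+ n.
  set gx := g n x; set Gx := G n x; set wx := w x;
    set cn := c n => Q0 Hc ca IHn.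
  have : (1 - q) * (Gx + Q * gx - wx) <= (1 - q) * (a + (q * Q) ^+ 2).
    rewrite ler_wpM2l ?subr_ge0 ?(ltW q1) //.
    exact: le_trans Hc ca.
  (* The error terms add up exactly: [(1 - q) * (q * Q) ^+ 2 + q * (1 - Q) * (q * Q) = (1 - q * Q) *
     (q * (q * Q))]. *)
  have := ler_wpM2l (ltW q0) IHn.
  lra.
(* Insert [h x <= G n.+1 x + q ^+ n.+1] into [G_a n] and divide by [q ^+ n]. The loss [3 * q] has
   one [q] from [h_close], one from the error in [G_a] and one from [w x >= -1]. *)
have g_large n : w x + (theta - 3 * q) <= g n x.
  have := G_a n; have := h_close x n.+1 Bx; rewrite ler_distl => /andP[_].
  have := w_le x Bx; rewrite GS (exprS q n); have := qn n; move: theta_a.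
  have -> : h x = a + w x by rewrite subrK.
  set Q := q ^+ n; set gx := g n x; set Gx := G n x; set wx := w x.
  move=> ta Q0 w1 hG Ga; have qQ : 0 < q * Q by rewrite mulr_gt0.
  have gw : a - 3 * q <= (1 - q) * (gx - wx).
    rewrite -(ler_pM2l Q0).
    have w1' : 0 <= q * Q * (1 + wx) by apply: mulr_ge0; [exact: ltW|lra].
    have QQ : 0 < q * Q * Q by rewrite mulr_gt0.
    lra.
  rewrite leNgt; apply/negP => gk.
  have : 0 < (1 - q) * (wx + (theta - 3 * q) - gx) by rewrite mulr_gt0 ?subr_gt0.
  have : 0 < q * (theta - 3 * q) by rewrite mulr_gt0 ?subr_gt0.
  lra.
(* Apply the generalized limit to [g_large]: [w x] is the limit of the [g n x], which stay above it
   by a fixed positive amount. *)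
have : w x + (theta - 3 * q) <= w x by apply: L_ge => //; near=> n;
  exact: g_large.
by rewrite gerDl leNgt subr_gt0 qtheta.
Unshelve. all: by end_near.
Qed.

End Core.

(* The diagonal subsequence provides [f_stable]. *)
Theorem james_not_attained (R : realType) (T : Type) (q theta : R) (B : set T)
    (f : nat -> T -> R) :
  0 < q -> q < 1 -> 3 * q < theta -> B !=set0 ->
  (forall x, exists b, forall n, `|f n x| <= b) ->
  (forall x, B x -> forall n, `|f n x| <= 1) ->
  (forall t, exists2 y, B y &
     \forall n \near \oo, theta <= mix q f t y - f n y) ->
  exists F : T -> R,
  [/\ forall a x y z, (forall n, f n z = a * f n x + f n y) ->
        F z = a * F x + F y,
      forall x b, (forall n, `|f n x| <= b) -> `|F x| <= 2 * b
    & forall x, B x -> exists2 y, B y & F x < F y].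
Proof.
move=> q0 q1 qt B0 fb f1 fsep.
(* Rational thresholds keep the index countable; for [f_stable] a rational between [c'] and [c]
   suffices. *)
pose Q (i : tree * rat) x n := B x /\ ratr i.2 < mix q f i.1 x - f n x.
have [s [s_homo sQ]] := diagonal_subseq Q.
have [||t x c Bx nc c' cc'|t|F [Flin Fbnd Fna]] :=
  @sup_not_attained R T q theta B (f \o s) q0 q1 qt B0.
- by move=> x; have [b fxb] := fb x; exists b => n; exact: fxb.
- by move=> x Bx n; exact: f1.
- have [r /[!in_itv]/= /andP[c'r rc]] := rat_in_itvoo cc'.
  have [|y [N yN]] := sQ (relabel s t, r).
    exists x => N; apply: contrapT => nN; apply: nc; exists N => // n /= Nn.
    rewrite leNgt; apply/negP => cn; apply: nN; exists n; split=> //;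
      split=> //=.
    by rewrite mix_relabel; exact: lt_trans cn.
  exists y; first by have [] := yN N (leqnn N).
  exists N => // n /= /yN[_] /=; rewrite mix_relabel => ry.
  exact: ltW (lt_trans c'r ry).
- have [y By [N _ yN]] := fsep (relabel s t); exists y => //.
  exists N => // n /= Nn; rewrite -mix_relabel; apply: yN => /=.
  by apply: leq_trans Nn _; exact: increasing_geq_id.
exists F; split=> // [a x y z fz|x b fxb];
  [exact: Flin (fun n => fz (s n))|exact: Fbnd (fun n => fxb (s n))].
Qed.

(** * The Hahn-Banach theorem *)

Section HahnBanach.
Context {R : realType} {E : lmodType R}.
Implicit Types (p u : E -> R).

Definition sublinear p := (forall x y, p (x + y) <= p x + p y) /\
  forall a x, 0 <= a -> p (a *: x) = a * p x.

Definition linear_functional u := forall a x y, u (a *: x + y) = a * u x + u y.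

Lemma sublinear0 p : sublinear p -> p 0 = 0.
Proof. by case=> _ /(_ 0 0 (lexx 0)); rewrite scale0r mul0r. Qed.

Lemma sublinear_geN p x : sublinear p -> - p (- x) <= p x.
Proof.
move=> ps; have := ps.1 x (- x); rewrite subrr (sublinear0 ps).
by rewrite addrC -lerBlDl sub0r.
Qed.

(** Subadditivity and homogeneity are asked only up to a change of index, and [l] keeps the infima
    finite. This covers both the shrinking of one sublinear function and the lower bound of a
    chain. *)
Lemma sublinear_inf (I : Type) (A : set I) (P : I -> E -> R) (l : E -> R) :
  A !=set0 -> (forall i x, A i -> l x <= P i x) ->
  (forall i j x y, A i -> A j -> exists2 k, A k & P k (x + y) <= P i x + P j y) ->
  (forall i a x, A i -> 0 < a -> exists2 k, A k & P k (a *: x) <= a * P i x) ->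
  l 0 = 0 -> (exists2 i, A i & P i 0 <= 0) ->
  sublinear (fun x => inf [set P i x | i in A]).
Proof.
move=> [i0 Ai0] Pl Padd Pscale l0 [i1 Ai1 Pi1].
pose S x := [set P i x | i in A].
have hi x : has_inf (S x).
  by split; [exists (P i0 x), i0|exists (l x) => _ [i Ai <-]; exact: Pl].
have inf_le i x : A i -> inf (S x) <= P i x.
  by move=> Ai; apply: ge_inf; [exact: (hi x).2|exists i].
have near_inf x e : 0 < e -> exists2 i, A i & P i x < inf (S x) + e.
  by move=> e0; have [_ [i Ai <-] ie] := inf_adherent e0 (hi x); exists i.
have scale_le a x : 0 < a -> inf (S (a *: x)) <= a * inf (S x).
  move=> a0; rewrite mulrC -ler_pdivrMr //.
  apply: lb_le_inf; first exact: (hi x).1.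
  move=> _ [i Ai <-]; rewrite ler_pdivrMr // mulrC.
  by have [k Ak] := Pscale i a x Ai a0; apply: le_trans; exact: inf_le.
split=> [x y|a x].
  apply/ler_addgt0Pr => e e0; have e2 : 0 < e / 2 by rewrite divr_gt0.
  have [i Ai ix] := near_inf x _ e2; have [j Aj jy] := near_inf y _ e2.
  have [k Ak kxy] := Padd i j x y Ai Aj; have := inf_le k (x + y) Ak.
  by rewrite -/(S _) -/(S x) -/(S y); lra.
rewrite le_eqVlt => /predU1P[<-|a0].
  rewrite scale0r mul0r; apply/eqP; rewrite eq_le; apply/andP; split.
    exact: le_trans (inf_le i1 0 Ai1) _.
  by apply: lb_le_inf; [exact: (hi 0).1|move=> _ [i Ai <-]; rewrite -l0 Pl].
apply/eqP; rewrite eq_le scale_le //= mulrC -ler_pdivlMr // mulrC.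
have := scale_le a^-1 (a *: x); rewrite invr_gt0 scalerA mulVf ?gt_eqF //.
by rewrite scale1r; apply.
Qed.

(* [p' x] is the infimum of [p (x + t *: z) - t * p z] over [t >= 0]; a minimal
   sublinear function cannot be shrunk, hence is odd, hence linear. *)
Lemma sublinear_shrink p z : sublinear p -> exists p',
  [/\ sublinear p', forall x, p' x <= p x & p' (- z) <= - p z].
Proof.
move=> ps; have [padd pscale] := ps.
pose P (t : R) x := p (x + t *: z) - t * p z.
pose A := [set t : R | 0 <= t].
have Pl t x : A t -> - p (- x) <= P t x.
  move=> t0; rewrite /P lerBrDr addrC lerBlDr -pscale //.
  by have := padd (x + t *: z) (- x); rewrite addrAC subrr add0r.
have hi x : has_lbound [set P i x | i in A].
  by exists (- p (- x)) => _ [t At <-]; exact: Pl.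
exists (fun x => inf [set P t x | t in A]); split.
- apply: (sublinear_inf (l := fun x => - p (- x))) => //.
  + by exists 0; exact: lexx.
  + move=> s t x y As At; exists (s + t); first exact: addr_ge0.
    rewrite /P scalerDl addrACA; have := padd (x + s *: z) (y + t *: z); lra.
  + move=> t a x At a0; exists (a * t); first by rewrite /A /= mulr_ge0 // ltW.
    by rewrite /P -scalerA -scalerDr pscale ?(ltW a0) // -mulrA -mulrBr.
  + by rewrite oppr0 sublinear0 // oppr0.
  + by exists 0; rewrite /A /P //= scale0r addr0 mul0r subr0 sublinear0.
- move=> x; apply: ge_inf; first exact: hi.
  by exists 0; rewrite /A /P //= scale0r addr0 mul0r subr0.
- apply: ge_inf; first exact: hi.
  by exists 1; rewrite /A /P //= scale1r addNr mul1r sublinear0 // sub0r.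
Qed.

(** Zorn's lemma: the pointwise infimum of a chain below [p] is sublinear, and finite because every
    member is at least [- p (- x)]. *)
Lemma minimal_sublinear p : sublinear p -> exists u,
  [/\ sublinear u, forall x, u x <= p x &
      forall v, sublinear v -> (forall x, v x <= u x) -> forall x, u x <= v x].
Proof.
move=> ps.
pose SP v := sublinear v /\ forall x, v x <= p x.
pose S := {v : E -> R | SP v}.
(* The order is reversed, so that a maximal element is a minimal function. *)
pose below (v w : S) := `[< forall x, sval w x <= sval v x >].
have [ | |A Atot|u umax] := @ZL_preorder S (exist SP p (conj ps (fun=> lexx _))) below.
- by move=> v; apply/asboolP.
- move=> v w t /asboolP vw /asboolP wt; apply/asboolP => x.
  exact: le_trans (wt x) (vw x).
- have [A0|A0] := pselect (A !=set0); last first.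
    exists (exist SP p (conj ps (fun=> lexx _))) => s As.
    by exfalso; apply: A0; exists s.
  have lb (i : S) x : A i -> - p (- x) <= sval i x.
    move=> _; have [si ip] := svalP i.
    by apply: le_trans (sublinear_geN x si); rewrite lerN2.
  have [i0 Ai0] := A0.
  have infs : sublinear (fun x => inf [set sval i x | i in A]).
    apply: (sublinear_inf (l := fun x => - p (- x))) => //.
    + move=> i j x y Ai Aj; have [/asboolP ij|/asboolP ji] := Atot i j Ai Aj.
        exists j => //; apply: le_trans ((svalP j).1.1 _ _) _.
        by rewrite lerD2r.
      exists i => //; apply: le_trans ((svalP i).1.1 _ _) _.
      by rewrite lerD2l.
    + by move=> i a x Ai a0; exists i => //; rewrite (svalP i).1.2 ?(ltW a0).
    + by rewrite oppr0 sublinear0 // oppr0.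
    + by exists i0 => //; rewrite (sublinear0 (svalP i0).1).
  have infle i x : A i -> inf [set sval i x | i in A] <= sval i x.
    move=> Ai; apply: ge_inf; last by exists i.
    by exists (- p (- x)) => _ [j Aj <-]; exact: lb.
  have infp x : inf [set sval i x | i in A] <= p x.
    by apply: le_trans (infle i0 x Ai0) _; exact: (svalP i0).2.
  exists (exist SP _ (conj infs infp)) => i Ai; apply/asboolP => x /=.
  exact: infle.
exists (sval u); split; [exact: (svalP u).1|exact: (svalP u).2|].
move=> v vs vu x.
have vp y : v y <= p y by apply: le_trans (vu y) _; exact: (svalP u).2.
have /asboolP := umax (exist SP v (conj vs vp)) (asboolT vu).
exact.
Qed.

(** Shrinking [p] at [x0] beforehand forces [u (- x0) <= - p x0], which for an odd [u] is the
    missing half of [u x0 = p x0]. *)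
Theorem hahn_banach p x0 : sublinear p ->
  exists u, [/\ linear_functional u, forall x, u x <= p x & u x0 = p x0].
Proof.
move=> ps; have [p1 [p1s p1p p1x0]] := sublinear_shrink x0 ps.
have [u [us up umin]] := minimal_sublinear p1s.
have uN z : u (- z) = - u z.
  apply/eqP; rewrite eq_le; apply/andP; split.
    have [v [vs vu vz]] := sublinear_shrink z us.
    exact: le_trans (umin v vs vu _) vz.
  by rewrite lerNl; exact: (sublinear_geN z us).
have uD x y : u (x + y) = u x + u y.
  apply/eqP; rewrite eq_le us.1 /= -lerBrDr -uN -[X in u X <= _](addrK y).
  exact: us.1.
have uZ a x : u (a *: x) = a * u x.
  have [a0|/ltW a0] := leP 0 a; first exact: us.2.
  by rewrite -{1}[a]opprK scaleNr uN us.2 ?oppr_ge0 // mulNr opprK.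
exists u; split=> [a x y|x|]; first by rewrite uD uZ.
  exact: le_trans (up x) (p1p x).
apply/eqP; rewrite eq_le (le_trans (up x0) (p1p x0)) /=.
by rewrite -lerN2 -uN; exact: le_trans (up _) p1x0.
Qed.

End HahnBanach.

(** * James' theorem *)

(* The separation theorem for the image of [S] under [(a, b)] and a quadrant. *)
Lemma separation_two (R : realType) (T : Type) (S : set T) (a b : T -> R) (o : T) :
  S o -> b o < 0 ->
  (forall l u v, 0 <= l <= 1 -> S u -> S v -> exists2 w, S w &
     a w = (1 - l) * a u + l * a v /\ b w = (1 - l) * b u + l * b v) ->
  (forall u, S u -> b u < 0 -> a u <= 0) ->
  exists2 t, 0 <= t & forall u, S u -> a u <= t * b u.
Proof.
move=> So bo cvx ab.
have ab0 u : S u -> b u = 0 -> a u <= 0.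
  move=> Su bu; rewrite leNgt; apply/negP => au.
  have d0 : 0 < a u + `|a o| + 1 by rewrite -addrA ltr_wpDr ?addr_ge0.
  (* This weight of [o] keeps [a] positive at the combination, since (1 - l) a u = l (|a o| + 1),
     while [b] becomes negative. *)
  pose l := a u / (a u + `|a o| + 1).
  have l0 : 0 < l by rewrite divr_gt0.
  have l1 : l <= 1 by rewrite ler_pdivrMr // mul1r -addrA lerDl addr_ge0.
  have [|w Sw [aw bw]] := cvx l u o _ Su So; first by rewrite ltW.
  have := ab w Sw; rewrite aw bw bu mulr0 add0r pmulr_rlt0 // => /(_ bo).
  have : l * (a u + `|a o| + 1) = a u by rewrite divfK // gt_eqF.
  have : l * - a o <= l * `|a o| by rewrite ler_pM2l // -normrN ler_norm.
  lra.
have ab_cross u v : S u -> S v -> b u < 0 -> 0 < b v -> a v / b v <= a u / b u.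
  move=> Su Sv bu bv.
  have d0 : 0 < b v - b u by lra.
  (* The weight at which [b] vanishes between [u] and [v]. *)
  pose l := - b u / (b v - b u).
  have lE : l * (b v - b u) = - b u by rewrite divfK // gt_eqF.
  have l0 : 0 <= l by rewrite divr_ge0 ?ltW // oppr_gt0.
  have l1 : l <= 1 by rewrite ler_pdivrMr // mul1r; lra.
  have [|w Sw [aw bw]] := cvx l u v _ Su Sv; first by rewrite l0.
  have bw0 : b w = 0 by rewrite bw; lra.
  have := ab0 w Sw bw0; rewrite aw => aw0.
  rewrite ler_pdivrMr // mulrAC ler_ndivlMr //.
  rewrite -(pmulr_rle0 _ d0) in aw0.
  have -> : a u * b v = (b v - b u) * ((1 - l) * a u + l * a v) + a v * b u.
    have -> : (b v - b u) * ((1 - l) * a u + l * a v) =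
      (b v - b u - l * (b v - b u)) * a u + l * (b v - b u) * a v by ring.
    by rewrite lE; ring.
  by rewrite gerDr.
(* The multiplier must lie above all [a v / b v] with [b v > 0] and below all [a u / b u] with
   [b u < 0]; the element 0 makes it nonnegative. *)
pose X := [set x | x = 0 \/ exists v, [/\ S v, 0 < b v & x = a v / b v]].
have X_ub u : S u -> b u < 0 -> ubound X (a u / b u).
  move=> Su bu x [->|[v [Sv bv ->]]]; last exact: ab_cross.
  by rewrite mulr_le0 ?invr_le0 ?ab // ltW.
have hX : has_sup X by split; [exists 0; left|exists (a o / b o); exact: X_ub].
exists (sup X) => [|u Su]; first by apply: ub_le_sup; [exact: hX.2|left].
have [bu|bu|bu] := ltgtP (b u) 0.
- by rewrite -ler_ndivlMr //; apply: ge_sup; [exact: hX.1|exact: X_ub].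
- rewrite -ler_pdivrMr //; apply: ub_le_sup; first exact: hX.2.
  by right; exists u.
- by rewrite bu mulr0; exact: ab0.
Qed.

Section James.
Context {R : realType} {E : lmodType R} (p : E -> R).
Implicit Types (u v : E -> R) (x y : E).
Hypothesis p_sublinear : sublinear p.
Hypothesis pN : forall x, p (- x) = p x.
Hypothesis p_eq0 : forall x, p x = 0 -> x = 0.
Hypothesis p_complete : forall s : nat -> E,
  (forall m n, p (s m - s n) <= m.+1%:R^-1 + n.+1%:R^-1) ->
  exists x, forall e, 0 < e -> \forall n \near \oo, p (s n - x) <= e.

Definition dual_ball : set (E -> R) :=
  [set u | linear_functional u /\ forall x, u x <= p x].

Definition bounded_functional : set (E -> R) :=
  [set u | linear_functional u /\ exists C, forall x, u x <= C * p x].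

Context (phi : (E -> R) -> R).
Hypothesis phi_linear : forall a b u v,
  bounded_functional u -> bounded_functional v ->
  phi (fun x => a * u x + b * v x) = a * phi u + b * phi v.
Hypothesis phi_bounded : exists C, forall u, dual_ball u -> phi u <= C.
Hypothesis phi_not_point :
  ~ exists x, forall u, bounded_functional u -> phi u = u x.

Lemma dual_ball_bounded u : dual_ball u -> bounded_functional u.
Proof. by move=> [ul up]; split=> //; exists 1 => x; rewrite mul1r. Qed.

Lemma p_ge0 x : 0 <= p x.
Proof. by have := sublinear_geN x p_sublinear; rewrite pN; lra. Qed.

Lemma functionalB u x y : linear_functional u -> u (x - y) = u x - u y.
Proof. by move=> ul; rewrite -[- y]scaleN1r addrC ul mulN1r addrC. Qed.

Lemma functional0 u : linear_functional u -> u 0 = 0.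
Proof. by move=> ul; rewrite -[in LHS](subrr 0) functionalB // subrr. Qed.

Lemma functionalN u x : linear_functional u -> u (- x) = - u x.
Proof. by move=> ul; rewrite -sub0r functionalB // functional0 // sub0r. Qed.

Lemma functionalZ u a x : linear_functional u -> u (a *: x) = a * u x.
Proof. by move=> ul; rewrite -[a *: x]addr0 ul functional0 // addr0. Qed.

Lemma dual_ballN u : dual_ball u -> dual_ball (fun x => - u x).
Proof.
move=> [ul up]; split=> [a x y|x]; first by rewrite ul; ring.
by rewrite -functionalN // -[p x]pN; exact: up.
Qed.

Lemma phi_scale u a : bounded_functional u ->
  phi (fun x => a * u x) = a * phi u.
Proof.
move=> ub; have := phi_linear a 0 ub ub; rewrite mul0r addr0 => <-.
by congr phi; apply/funext => x; rewrite mul0r addr0.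
Qed.

Lemma phiN u : dual_ball u -> phi (fun x => - u x) = - phi u.
Proof.
move=> /dual_ball_bounded /(phi_scale (-1)); rewrite mulN1r => <-.
by congr phi; apply/funext => x; rewrite mulN1r.
Qed.

Lemma dual_ball_convex l u v : 0 <= l <= 1 -> dual_ball u -> dual_ball v ->
  dual_ball (fun x => (1 - l) * u x + l * v x).
Proof.
move=> /andP[l0 l1] [ul up] [vl vp]; split=> [a x y|x]; first by rewrite ul vl;
  ring.
have l1' : 0 <= 1 - l by rewrite subr_ge0.
by have := ler_wpM2l l1' (up x); have := ler_wpM2l l0 (vp x); lra.
Qed.

(** Otherwise some points [s n] represent [phi] on the dual ball up to [n.+1%:R^-1]. By Hahn-Banach
    they are Cauchy at the rate asked by [p_complete], and their limit represents [phi]. *)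
Lemma phi_dist_gt0 : exists2 theta, 0 < theta &
  forall x, exists2 u, dual_ball u & theta < phi u - u x.
Proof.
apply: contrapT => H; apply: phi_not_point.
have close (n : nat) : exists x, forall u, dual_ball u -> phi u - u x <= n.+1%:R^-1.
  apply: contrapT => nx; apply: H; exists n.+1%:R^-1; first by rewrite invr_gt0.
  move=> x; apply: contrapT => nu; apply: nx; exists x => u uD.
  by rewrite leNgt; apply/negP => ux; apply: nu; exists u.
have [s sP] := choice close.
have [m n|x sx] := @p_complete s.
  have [u [ul up <-]] := hahn_banach (s m - s n) p_sublinear.
  have uD : dual_ball u by [].
  rewrite functionalB //.
  have := sP m _ (dual_ballN uD); rewrite phiN //=.
  have := sP n _ uD.
  by move: (m.+1%:R^-1) (n.+1%:R^-1) => ? ?; lra.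
have phi_le u : dual_ball u -> phi u <= u x.
  move=> uD; have [ul up] := uD; apply/ler_addgt0Pr => e e0.
  have e2 : 0 < e / 2 by rewrite divr_gt0.
  have [n [n1 n2]] : exists n : nat, n.+1%:R^-1 <= e / 2 /\ p (s n - x) <= e / 2.
    have [N1 _ N1P] := sx _ e2.
    have [N2 _ N2P] := near_infty_natSinv_lt (PosNum e2).
    exists (maxn N1 N2); split; last by apply: N1P; exact: leq_maxl.
    by apply/ltW/N2P; exact: leq_maxr.
  have := sP n _ uD; have := up (s n - x); rewrite functionalB //.
  by move: (n.+1%:R^-1) n1 => r; lra.
have phi_eq u : dual_ball u -> phi u = u x.
  move=> uD; apply/eqP; rewrite eq_le phi_le //= -lerN2 -phiN //.
  exact/phi_le/dual_ballN.
exists x => u ub; have [ul [C uC]] := ub.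
have C0 : 0 < `|C| + 1 by rewrite ltr_wpDl.
have vD : dual_ball (fun x => (`|C| + 1)^-1 * u x).
  split=> [a y z|y]; first by rewrite ul; ring.
  rewrite mulrC ler_pdivrMr // mulrC; apply: le_trans (uC y) _.
  by rewrite ler_wpM2r ?p_ge0 // (le_trans (ler_norm _)) // lerDl.
have := phi_eq _ vD; rewrite phi_scale //; apply: mulfI.
by rewrite invr_eq0 gt_eqF.
Qed.

(** Induction on [ys]. If no functional met the constraint at a new point [y], separation would give
    [t >= 0] with [phi u - u z - theta <= t * (u y - e)] for all admissible [u], contradicting the
    induction hypothesis at [t *: y + z]. This is why the induction runs over all shifts [z]. *)
Lemma separating_functional (theta e : R) (ys : seq E) : 0 < e ->
  (forall x, exists2 u, dual_ball u & theta < phi u - u x) ->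
  exists u, [/\ dual_ball u, theta < phi u & all (fun y => u y < e) ys].
Proof.
move=> e0 dist.
suff /(_ 0) [u [uD us]] : forall z, exists u,
    [/\ dual_ball u, all (fun y => u y < e) ys & theta < phi u - u z].
  by rewrite functional0 ?subr0; [exists u|exact: uD.1].
elim: ys => [|y ys IH] z; first by have [u] := dist z; exists u.
pose S := [set u | dual_ball u /\ all (fun y => u y < e) ys].
apply: contrapT => nu.
have S0 : S (fun=> 0).
  split; last by apply/allP => x _.
  by split=> [a x x'|x]; [rewrite mulr0 addr0|exact: p_ge0].
have [|l u v l01 [uD uys] [vD vys]|u [uD uys] uy|t t0 tP] := @separation_two _ _ S
    (fun u => phi u - u z - theta) (fun u => u y - e) (fun=> 0) S0.
- by rewrite sub0r oppr_lt0.
- exists (fun x => (1 - l) * u x + l * v x).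
    split; first exact: dual_ball_convex.
    apply/allP => x xys; have /allP/(_ x xys) := uys;
      have /allP/(_ x xys) := vys.
    case/andP: l01 => l0 l1 /= vx ux.
    have me : Num.max (u x) (v x) < e by rewrite gt_max ux.
    apply: le_lt_trans me;
      have um : u x <= Num.max (u x) (v x) by rewrite le_max lexx.
    have vm : v x <= Num.max (u x) (v x) by rewrite le_max lexx orbT.
    by move: (Num.max _ _) um vm => m um vm; nra.
  by rewrite phi_linear; [split; ring|exact: dual_ball_bounded..].
- rewrite leNgt subr_gt0; apply/negP => ut; apply: nu; exists u; split=> //.
  by rewrite /= uys -subr_lt0 uy.
have [u [uD uys]] := IH (t *: y + z); have [ul _] := uD.
have := tP u (conj uD uys); rewrite ul.
have : 0 <= t * e by apply: mulr_ge0 => //; exact: ltW.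
lra.
Qed.

(** If [u] stayed below [k = theta / (2 * C)] on the unit ball, [u] divided by [k] would be in the
    dual ball, so that [phi u <= C * k = theta / 2]. *)
Lemma norming_point u theta C : dual_ball u -> theta <= phi u -> 0 < C -> 0 < theta ->
  (forall v, dual_ball v -> phi v <= C) ->
  exists2 y, p y <= 1 & theta / (2 * C) <= u y.
Proof.
move=> uD thu C0 th0 phiC; have [ul up] := uD; apply: contrapT => ny.
set k := theta / (2 * C); have k0 : 0 < k by rewrite divr_gt0 // mulr_gt0.
have uk y : p y <= 1 -> u y < k.
  by move=> py; rewrite ltNge; apply/negP => ky; apply: ny; exists y.
have vD : dual_ball (fun x => k^-1 * u x).
  split=> [a x y|x]; first by rewrite ul; ring.
  have [/p_eq0 ->|px] := eqVneq (p x) 0;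
    first by rewrite functional0 // mulr0 p_ge0.
  have px0 : 0 < p x by rewrite lt_neqAle eq_sym px p_ge0.
  rewrite mulrC ler_pdivrMr //; apply/ltW.
  have := uk ((p x)^-1 *: x);
    rewrite (functionalZ _ _ ul) p_sublinear.2 ?invr_ge0 ?p_ge0 //.
  by rewrite mulVf // lexx mulrC ltr_pdivrMr // mulrC => /(_ isT).
have := phiC _ vD; rewrite phi_scale; last exact: dual_ball_bounded.
have Ck : C * k = theta / 2 by rewrite /k; field; rewrite gt_eqF.
by rewrite mulrC ler_pdivrMr // Ck; lra.
Qed.

(** A strict bound on the leaves: a mixture of a sequence under construction is final once this many
    terms are fixed. *)
Fixpoint leaf_bound t : nat :=
  match t with
  | Leaf n => n.+1
  | Node t u => maxn (leaf_bound t) (leaf_bound u)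
  end.

Lemma eq_mix q (f g : nat -> E -> R) t :
  (forall k, (k < leaf_bound t)%N -> f k = g k) -> mix q f t = mix q g t.
Proof.
elim: t => [n|t IHt u IHu] /= fg; first by rewrite fg.
apply/funext => x; rewrite IHt ?IHu // => k kt; apply: fg.
  by rewrite (leq_trans kt) ?leq_maxr.
by rewrite (leq_trans kt) ?leq_maxl.
Qed.

Lemma mix_dual_ball q (f : nat -> E -> R) theta t : 0 <= q <= 1 ->
  (forall n, dual_ball (f n) /\ theta <= phi (f n)) ->
  dual_ball (mix q f t) /\ theta <= phi (mix q f t).
Proof.
move=> q01 fP; elim: t => [n|t [tD tp] u [uD up]]; first exact: fP.
split; first exact: dual_ball_convex.
rewrite /= phi_linear; [|exact: dual_ball_bounded..].
by case/andP: q01 => q0 q1; nra.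
Qed.

Theorem james : exists F : E -> R,
  [/\ linear_functional F, exists C, forall x, `|F x| <= C * p x
    & forall x, p x <= 1 -> exists2 y, p y <= 1 & F x < F y].
Proof.
have [theta th0 dist] := phi_dist_gt0.
have [C C0 phiC] : exists2 C, 0 < C & forall u, dual_ball u -> phi u <= C.
  have [C phiC] := phi_bounded; exists (`|C| + 1); first by rewrite ltr_wpDl.
  by move=> u /phiC /le_trans; apply; rewrite (le_trans (ler_norm _)) // lerDl.
set k := theta / (2 * C); have k0 : 0 < k by rewrite divr_gt0 // mulr_gt0.
have k20 : 0 < k / 2 by rewrite divr_gt0.
(* Small enough for both [q < 1] and [3 * q < k / 2]. *)
pose q := k / (12 * (1 + k)).
have k1 : 0 < 12 * (1 + k) by rewrite mulr_gt0 // addr_gt0.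
have q0 : 0 < q by rewrite divr_gt0.
have qE : q * (12 * (1 + k)) = k by rewrite divfK // gt_eqF.
have q1 : q < 1 by rewrite ltr_pdivrMr // mul1r; lra.
have qk : 3 * q < k / 2 by have : 0 < q * k by [rewrite mulr_gt0]; lra.
have q01 : 0 <= q <= 1 by rewrite !ltW.
have peak_ex (u : E -> R) : exists y, dual_ball u -> theta <= phi u ->
    p y <= 1 /\ k <= u y.
  have [[uD ut]|nu] := pselect (dual_ball u /\ theta <= phi u).
    by have [y ? ?] := norming_point uD ut C0 th0 phiC; exists y.
  by exists 0 => uD ut; exfalso; apply: nu.
have [peak peakP] := choice peak_ex.
have [sel selP] := choice (fun ys => separating_functional ys k20 dist).
(* The [n]-th functional is below [k / 2] at the peaks of the mixtures with code below [n]. A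
   mixture of the final sequence is at least [k] at its peak, so it eventually exceeds [f n] there
   by [k / 2]. *)
pose next n (g : nat -> E -> R) :=
  sel [seq peak (mix q g t) | t <- pmap unpickle (iota 0 n)].
(* [G n] holds the first [n] functionals and is zero beyond. *)
pose G := fix G n : nat -> E -> R :=
  if n is m.+1 then fun j => if j == m then next m (G m) else G m j else fun _ _ => 0.
pose f n := next n (G n).
have G_f n j : (j < n)%N -> G n j = f j.
  elim: n => // n IHn; rewrite ltnS /= leq_eqVlt.
  by case: eqP => [-> //|_] /= /IHn.
have fP n : dual_ball (f n) /\ theta <= phi (f n).
  by have [uD /ltW ut _] := selP [seq peak (mix q (G n) t) | t <- pmap unpickle (iota 0 n)].
have f_le n x : `|f n x| <= p x.
  have [[fl fp] _] := fP n; rewrite ler_norml fp andbT lerNl.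
  by rewrite -functionalN // -[p x]pN.
have [||x px n|t|F [F_lin F_bnd F_na]] :=
  @james_not_attained R E q (k / 2) [set x | p x <= 1] f q0 q1 qk.
- by exists 0; rewrite /= sublinear0.
- by move=> x; exists (p x) => n; exact: f_le.
- exact: le_trans (f_le n x) px.
- have [uD ut] := mix_dual_ball t q01 fP.
  have [py ky] := peakP _ uD ut; exists (peak (mix q f t)) => //.
  (* From here on [t] is among the enumerated codes and [G n] agrees with [f] on its leaves. *)
  exists (maxn (leaf_bound t) (pickle t).+1) => // n /=;
    rewrite geq_max => /andP[tn pn].
  have [_ _ /allP/(_ (peak (mix q f t)))] :=
    selP [seq peak (mix q (G n) t) | t <- pmap unpickle (iota 0 n)].
  rewrite -/(next n (G n)) -/(f n) => fy.
  suff /fy : peak (mix q f t) \in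
      [seq peak (mix q (G n) t) | t <- pmap unpickle (iota 0 n)] by lra.
  apply/mapP; exists t; last first.
    by congr peak; apply: eq_mix => j jt; rewrite G_f // (leq_trans jt).
  rewrite mem_pmap; apply/mapP; exists (pickle t); last by rewrite pickleK.
  by rewrite mem_iota.
exists F; split=> //.
- by move=> a x y; apply: F_lin => n; have [[fl _] _] := fP n; rewrite fl.
- by exists 2 => x; apply: F_bnd => n; exact: f_le.
Qed.

Corollary james_sup : exists F : E -> R, exists s : R,
  [/\ linear_functional F, 0 < s, forall x, p x <= 1 -> F x < s
    & forall t, t < s -> exists2 x, p x <= 1 & t < F x].
Proof.
have [F [F_lin [C FC] F_na]] := james.
pose V := [set F x | x in [set x | p x <= 1]].
have V0 : V !=set0 by exists (F 0), 0; rewrite //= sublinear0.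
have hV : has_sup V.
  split=> //; exists `|C| => _ [x /= px <-].
  apply: le_trans (ler_norm _) _; apply: le_trans (FC x) _.
  apply: le_trans (ler_wpM2r (p_ge0 x) (ler_norm C)) _.
  by rewrite ler_piMr.
have F_lt x : p x <= 1 -> F x < sup V.
  move=> /F_na[y py xy]; apply: lt_le_trans xy _; apply: ub_le_sup;
    first exact: hV.2.
  by exists y.
exists F, (sup V); split=> // [|t ts].
  by rewrite -(functional0 F_lin); apply: F_lt; rewrite sublinear0.
by have [_ [x px <-] tx] := sup_gt V0 ts; exists x.
Qed.

End James.

(** * Operators on the scalar sum *)

Lemma infimum_eq (K : numFieldType) (x0 : K) (A : set K) (m : K) :
  A !=set0 -> infimums A m -> infimum x0 A = m.
Proof.
move=> /set0P/negbTE A0 Am; rewrite /infimum A0;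
  apply: xget_unique => // m' Am'.
by apply/eqP; rewrite eq_le (Am.2 _ Am'.1) (Am'.2 _ Am.1).
Qed.

Lemma phaseP (K : numFieldType) (z : K) : exists2 c : K, `|c| <= 1 & c * z = `|z|.
Proof.
have [->|z0] := eqVneq z 0; first by exists 1; rewrite ?normr1 // mulr0 normr0.
exists (`|z| / z); last by rewrite divfK.
by rewrite normrM normr_id normfV divff // normr_eq0.
Qed.

Section MinModulus.
Context {K : numFieldType} {Y : normedModType K} (g : Y -> K^o) (s : K).
Hypothesis g_linear : linear g.
Hypothesis s_gt0 : 0 < s.
Hypothesis g_lt : forall y, `|y| <= 1 -> `|g y| < s.
Hypothesis g_sup : forall t, t < s -> exists2 y, `|y| <= 1 & t < `|g y|.

Let X := scalar_sum Y.
Let m := (1 + s)^-1.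

Definition shear (x : X) : X := (x.1 - g x.2, x.2).
Definition shift (x : X) : X := (g x.2, 0).

Lemma scalar_sum_norm_le (x : X) c : (`|x| <= c) = (`|x.1| <= c) && (`|x.2| <= c).
Proof.
by case: x => a y;
  rewrite scalar_sum_normE comparable_ge_max // real_comparable.
Qed.

Lemma scalar_sum_norm_lt (x : X) c : (`|x| < c) = (`|x.1| < c) && (`|x.2| < c).
Proof.
by case: x => a y;
  rewrite scalar_sum_normE comparable_gt_max // real_comparable.
Qed.

Lemma scalar_sum_norm_gt (x : X) c : (c < `|x|) = (c < `|x.1|) || (c < `|x.2|).
Proof.
by case: x => a y;
  rewrite scalar_sum_normE comparable_lt_max // real_comparable.
Qed.

Let g0 : g 0 = 0.
Proof. by have := g_linear (-1) 0 0; rewrite scaler0 addr0 scaleN1r addNr. Qed.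

Let gZ a y : g (a *: y) = a * g y.
Proof. by rewrite -[a *: y]addr0 g_linear g0 addr0. Qed.

Let g_lt_norm y : y != 0 -> `|g y| < s * `|y|.
Proof.
move=> y0; have ny : 0 < `|y| by rewrite normr_gt0.
have : `|g (`|y|^-1 *: y)| < s.
  by apply: g_lt; rewrite normrZ normfV normr_id mulVf // gt_eqF.
by rewrite gZ normrM normfV normr_id mulrC ltr_pdivrMr.
Qed.

Let g_le y : `|g y| <= s * `|y|.
Proof.
have [->|/g_lt_norm/ltW //] := eqVneq y 0.
by rewrite g0 !normr0 mulr0.
Qed.

Let s1_gt0 : 0 < 1 + s. Proof. by rewrite addr_gt0. Qed.
Let m_gt0 : 0 < m. Proof. by rewrite invr_gt0. Qed.
Let m_lt1 : m < 1. Proof. by rewrite invf_lt1 // ltrDl. Qed.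
Let sm : s * m = 1 - m.
Proof. by rewrite /m; field; rewrite gt_eqF. Qed.

(** If the second component has norm at most [m < 1], the first has norm 1, and the strict bound on
    [g] gives a value smaller than [s * m = 1 - m]. *)
Lemma shear_norm_gt (x : X) : `|x| = 1 -> m < `|shear x|.
Proof.
move=> x1; rewrite scalar_sum_norm_gt /=.
have [//|ym] := real_ltP (gtr0_real m_gt0) (normr_real x.2);
  first by rewrite orbT.
rewrite orbF.
have a1 : `|x.1| = 1.
  apply/eqP; rewrite eq_le; have := lexx (1 : K); rewrite -{1}x1.
  rewrite scalar_sum_norm_le => /andP[-> _] /=.
  rewrite real_leNgt ?normr_real ?real1 //; apply/negP => a1.
  have := ltxx (1 : K); rewrite -[X in X < _]x1 scalar_sum_norm_lt a1 /=.
  by rewrite (le_lt_trans ym m_lt1).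
have gm : `|g x.2| < 1 - m.
  have [->|/g_lt_norm gy] := eqVneq x.2 0; first by rewrite g0 normr0 subr_gt0.
  by apply: lt_le_trans gy _; rewrite -sm ler_pM2l.
rewrite ltrBrDr -ltrBrDl in gm.
apply: lt_le_trans gm _.
rewrite -{1}a1; exact: lerB_dist.
Qed.

Lemma shear_linear : linear shear.
Proof.
move=> a [b y] [c z]; rewrite /shear /= g_linear; congr pair.
by rewrite opprD addrACA -scalerBr.
Qed.

Lemma shift_linear : linear shift.
Proof.
move=> a [b y] [c z]; rewrite /shift /= g_linear; congr pair.
by rewrite /= scaler0 addr0.
Qed.

Lemma shear_bounded : @bounded_operator K X X shear.
Proof.
split; first exact: shear_linear.
exists (1 + s) => x; have := lexx `|x|;
  rewrite scalar_sum_norm_le => /andP[x1 x2].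
rewrite scalar_sum_norm_le /= mulrDl mul1r; apply/andP; split; last first.
  by rewrite (le_trans x2) // lerDl mulr_ge0 // ltW.
apply: le_trans (ler_normB _ _) _; apply: lerD => //.
by apply: le_trans (g_le _) _; rewrite ler_pM2l.
Qed.

(** The image of the unit ball lies in a copy of the scalar disc of radius [s]; the premise is local
    compactness of the scalars, supplied separately for the reals and the complex numbers. *)
Lemma shift_compact : (exists2 A : set K^o, compact A & forall z, `|z| <= s -> A z) ->
  @compact_operator K X X shift.
Proof.
move=> [A A_compact As]; split; first exact: shift_linear.
pose emb (z : K^o) : X := (z, 0).
have emb_compact : compact (emb @` A).
  apply: continuous_compact A_compact; apply: continuous_subspaceT => z.
  by apply: (@cvg_pair _ _ _ (nbhs z) (nbhs z) (nbhs (0 : Y)));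
    [exact: cvg_id|exact: cvg_cst].
have := compact_closed (@norm_hausdorff _ X) emb_compact.
move=> /precompact_closed prec; rewrite -prec in emb_compact.
apply: precompact_subset emb_compact => _ [x /= x1 <-].
exists (g x.2) => //=; apply: As; apply: le_trans (g_le _) _.
by move: x1; rewrite /unit_ball /= scalar_sum_norm_le => /andP[_ x21];
  rewrite ler_piMr // ltW.
Qed.

Lemma unit_sphere10 : @unit_sphere K X (1, 0).
Proof. by rewrite /unit_sphere /= scalar_sum_normE normr1 normr0 max_l. Qed.

Lemma shear_min_modulus : @min_modulus K X X shear = m.
Proof.
apply: infimum_eq; first by exists `|shear (1, 0)|, (1, 0) => //;
  exact: unit_sphere10.
split=> [_ [x x1 <-]|l lP]; first exact/ltW/shear_norm_gt.
(* The order of [K] is partial, but [l] lies below a norm and is therefore real. *)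
have l_real : l \is Num.real.
  have : l <= `|shear (1, 0)| by apply: lP; exists (1, 0) => //;
    exact: unit_sphere10.
  by move/ler_real ->; exact: normr_real.
rewrite real_leNgt ?(gtr0_real m_gt0) //; apply/negP => ml.
have l0 : 0 < l by exact: lt_trans ml.
(* This threshold is equivalent to [b < l] for the [b] below. *)
have [|y y1 ty] := @g_sup (l^-1 - 1).
  by rewrite ltrBlDl -[1 + s]invrK ltf_pV2 ?posrE.
pose b := (1 + `|g y|)^-1.
have gy1 : 0 < 1 + `|g y| by rewrite ltr_pwDl.
have b0 : 0 < b by rewrite invr_gt0.
have b1 : b <= 1 by rewrite invf_le1 // lerDl.
have bl : b < l.
  by rewrite /b -[l]invrK ltf_pV2 ?posrE ?invr_gt0 // -ltrBlDl.
have [c c1 cg] := phaseP (g y).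
(* The phase [c] makes [g] equal to its absolute value, so both components of [shear x] have norm at
   most [b]. *)
pose x : X := (1, (b * c) *: y).
have xb : `|x.2| <= b.
  rewrite /= normrZ normrM (gtr0_norm b0) -mulrA ler_piMr ?(ltW b0) //.
  by rewrite mulr_ile1.
have x1 : `|x| = 1.
  apply/eqP;
    rewrite eq_le scalar_sum_norm_le /= normr1 lexx /= (le_trans xb b1) /=.
  by have := lexx `|x|; rewrite scalar_sum_norm_le /= normr1 => /andP[].
have := lP `|shear x| (ex_intro2 _ _ x x1 erefl).
apply/negP; rewrite -real_ltNge ?normr_real //; apply: le_lt_trans bl.
rewrite scalar_sum_norm_le xb andbT /= gZ -mulrA cg.
have -> : 1 - b * `|g y| = b by rewrite /b; field; rewrite gt_eqF.
by rewrite gtr0_norm.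
Qed.

Lemma shear_not_CPPm : (exists2 A : set K^o, compact A & forall z, `|z| <= s -> A z) ->
  ~ CPPm X X.
Proof.
move=> disc /(_ shear shear_bounded) [].
  by move=> [x x1]; rewrite shear_min_modulus => xm; have := shear_norm_gt x1;
    rewrite xm ltxx.
move=> ub _; have : 1 <= m.
  rewrite -shear_min_modulus; apply: ub; exists shift;
    first exact: shift_compact.
  have -> : shear \+ shift = id.
    by apply/funext => -[a y]; rewrite /shear /shift /=; congr pair;
      rewrite ?subrK ?addr0.
  rewrite (_ : min_modulus _ = 1) //; apply: infimum_eq.
    by exists `|(1, 0) : X|, (1, 0) => //; exact: unit_sphere10.
  split=> [_ [x x1 <-]|l lP]; first by rewrite x1.
  have := lP `|(1, 0) : X|; rewrite unit_sphere10; apply.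
  by exists (1, 0); [exact: unit_sphere10|exact: unit_sphere10].
by move=> /(lt_le_trans m_lt1); rewrite ltxx.
Qed.

End MinModulus.

(** * The real and the complex case *)

Lemma cauchy_seq_converges (K : numFieldType) (Y : completeNormedModType K)
    (s : nat -> Y) :
  (forall e, 0 < e -> exists N, forall n, (N <= n)%N -> `|s N - s n| < e) ->
  exists x, forall e, 0 < e -> \forall n \near \oo, `|s n - x| <= e.
Proof.
move=> s_cauchy.
have /cauchy_cvgP/cvg_ex[x sx] : cauchy (s @ \oo).
  apply: cauchy_exP => e /s_cauchy[N NP]; exists (s N); exists N => // n /= /NP.
  by rewrite -ball_normE.
by exists x => e e0; move/cvgrPdist_le : sx => /(_ e e0);
  under eq_near do rewrite distrC.
Qed.

(** * Elements of the bidual: linear combinations and bounds on the dual ball *)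

Section Bidual.
Context {K : numFieldType} {Y : normedModType K}.
Implicit Types f g : Y -> K^o.

Lemma dual_lincomb (a b : K) f g : dual f -> dual g ->
  dual (fun y => a * f y + b * g y : K^o).
Proof.
move=> [fl [C fC]] [gl [D gD]]; split=> [c y z|].
  by rewrite fl gl /GRing.scale /=; ring.
exists (`|a| * C + `|b| * D) => y; apply: le_trans (ler_normD _ _) _.
by rewrite !normrM mulrDl -!mulrA lerD // ler_wpM2l.
Qed.

Lemma operator_norm_ge0_le1 f : (forall y, `|f y| <= `|y|) ->
  0 <= operator_norm f <= 1.
Proof.
(* In the default branches of [supremum] the value is 0, which also satisfies the bounds. *)
move=> f1; rewrite /operator_norm /supremum; case: ifPn => _;
  first by rewrite lexx ler01.
case: xgetP => [m _ [ub lub]|_]; last by rewrite lexx ler01.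
apply/andP; split.
  apply: le_trans (normr_ge0 (f 0)) _; apply: ub; exists 0 => //.
  by rewrite /unit_ball /= normr0.
by apply: lub => _ [y y1 <-]; exact: le_trans (f1 y) y1.
Qed.

Context (phi : (Y -> K^o) -> K).
Hypothesis phi_bidual : bidual phi.

Lemma bidual_lincomb (a b : K) f g : dual f -> dual g ->
  phi (fun y => a * f y + b * g y) = a * phi f + b * phi g.
Proof.
move=> fd gd; have [phi_lin _] := phi_bidual.
have bgd : dual (b \*: g).
  by have := dual_lincomb 0 b fd gd; congr dual; apply/funext => y;
    rewrite mul0r add0r.
have zd : dual ((fun=> 0) : Y -> K^o).
  by have := dual_lincomb 0 0 fd gd; congr dual; apply/funext => y;
    rewrite !mul0r addr0.
have phi0 : phi (fun=> 0) = 0.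
  have := phi_lin (-1) _ _ zd zd; rewrite mulN1r addNr => phi0;
    rewrite -[RHS]phi0; congr phi.
  by apply/funext => y /=; rewrite scaler0 addr0.
have phiZ : phi (b \*: g) = b * phi g.
  rewrite -[RHS]addr0 -phi0 -phi_lin //; congr phi.
  by apply/funext => y /=; rewrite addr0.
by rewrite -phiZ -phi_lin.
Qed.

Lemma bidual_bounded : exists C : K, forall f, dual f ->
  (forall y, `|f y| <= `|y|) -> `|phi f| <= C.
Proof.
have [_ [C phiC]] := phi_bidual;
  exists `|C| => f fd /operator_norm_ge0_le1/andP[f0 f1].
(* [C] is an arbitrary scalar, but this product dominates a norm, so it is nonnegative and equals
   its absolute value. *)
have h : 0 <= C * operator_norm f by exact: le_trans (phiC f fd).
apply: le_trans (phiC f fd) _.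
by rewrite -(ger0_norm h) normrM (ger0_norm f0) ler_piMr.
Qed.

End Bidual.

Lemma real_not_CPPm (R : realType) (Y : completeNormedModType R) :
  ~ reflexive_space Y -> ~ CPPm (scalar_sum Y) (scalar_sum Y).
Proof.
move=> /existsNP[phi /not_implyP[phi_bidual phi_not_point]].
pose p (y : Y) := `|y|.
have dualE u : bounded_functional p u -> dual (u : Y -> R^o).
  move=> [ul [C uC]]; split; first exact: ul.
  exists C => y; rewrite ler_norml uC andbT lerNl -functionalN //.
  by rewrite -[`|y|]normrN; exact: uC.
have p_sub : sublinear p.
  by split=> [x y|a x a0]; rewrite /p ?ler_normD // normrZ ger0_norm.
have [||||||F [s [F_lin s0 Fs Fsup]]] := @james_sup R Y p p_sub _ _ _ phi.
- exact: normrN.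
- exact: normr0_eq0.
- move=> s s_close; apply: cauchy_seq_converges => e e0.
  have e2 : 0 < e / 2 by rewrite divr_gt0.
  have [N _ NP] := near_infty_natSinv_lt (PosNum e2).
  exists N => n Nn; apply: le_lt_trans (s_close N n) _.
  have := NP N (leqnn N); have := NP n Nn => /=.
  by move: (n.+1%:R^-1) (N.+1%:R^-1) => ? ?; lra.
- by move=> a b u v /dualE ud /dualE vd; exact: bidual_lincomb.
- have [C phiC] := bidual_bounded phi_bidual; exists C => u [ul up].
  have ud : bounded_functional p u by split=> //; exists 1 => y; rewrite mul1r.
  apply: le_trans (ler_norm _) _; apply: phiC; first exact: dualE.
  by move=> y;
    rewrite ler_norml up andbT lerNl -functionalN // -[`|y|]normrN up.
- move=> [x xP]; apply: phi_not_point; exists x => f [fl [C fC]]; apply: xP.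
  by split=> //; exists C => y; apply: le_trans (ler_norm _) (fC y).
apply: (@shear_not_CPPm R Y F s) => //.
- by move=> y y1;
  rewrite ltr_norml Fs // andbT ltrNl -functionalN // Fs // /p normrN.
- by move=> t /Fsup[y y1 tF]; exists y => //;
  apply: lt_le_trans tF (ler_norm _).
- exists `[- s, s]%classic; first exact: segment_compact.
  by move=> z zs; rewrite /= in_itv /= -ler_norml.
Qed.

(** The disc lies in a square, which is the continuous image of a compact product of segments. *)
Lemma complex_box_compact (R : realType) (s : R) :
  exists2 A : set R[i]^o, compact A & forall z : R[i], `|z| <= s%:C -> A z.
Proof.
pose h (z : R * R) : R[i]^o := (z.1 +i* z.2)%C.
have h_cont : continuous h.
  move=> [a b]; apply/cvgrPdist_le => e e0.
  have [r er] : exists r : R, e = r%:C by apply/complex_realP; exact: gtr0_real.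
  rewrite er ltcR in e0; have r2 : 0 < r / 2 by rewrite divr_gt0.
  have near_c (c : R) : \forall x \near c, `|c - x| <= r / 2.
    by have /cvgrPdist_le/(_ _ r2) := @cvg_id _ (nbhs c).
  have near_ab : \forall z \near (a, b), `|a - z.1| <= r / 2 /\ `|b - z.2| <= r / 2.
    exists ([set x | `|a - x| <= r / 2], [set x | `|b - x| <= r / 2]) => //.
    by split; exact: near_c.
  near=> z.
  have [za zb] : `|a - z.1| <= r / 2 /\ `|b - z.2| <= r / 2 by near: z.
  rewrite er normc_def /= lecR -[leRHS]gtr0_norm // -sqrtr_sqr ler_wsqrtr //.
  move: za zb; rewrite !ler_norml => /andP[? ?] /andP[? ?].
  nra.
exists (h @` (`[- s, s]%classic `*` `[- s, s]%classic)).
  apply: continuous_compact; first exact: continuous_subspaceT.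
  by apply: compact_setX; exact: segment_compact.
move=> [a b]; rewrite normc_def lecR /= => abs.
have s0 : 0 <= s by apply: le_trans abs; exact: sqrtr_ge0.
exists (a, b) => //; split; rewrite /= in_itv /= -ler_norml -sqrtr_sqr.
  by apply: (le_trans _ abs); rewrite ler_wsqrtr // lerDl sqr_ge0.
by apply: (le_trans _ abs); rewrite ler_wsqrtr // lerDr sqr_ge0.
Unshelve. all: by end_near.
Qed.

(** * A complex normed space viewed as a real one *)

Definition realification (R : realType) (Y : normedModType R[i]) : Type := Y.

Section Realification.
Context {R : realType} {Y : normedModType R[i]}.

HB.instance Definition _ := GRing.Zmodule.on (realification Y).

Let scale (r : R) (y : realification Y) : realification Y := r%:C *: (y : Y).

Let scaleA a b v : scale a (scale b v) = scale (a * b) v.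
Proof. by rewrite /scale scalerA rmorphM. Qed.

Let scale1 : left_id 1 scale.
Proof. by move=> v; rewrite /scale rmorph1 scale1r. Qed.

Let scaleDr : right_distributive scale +%R.
Proof. by move=> a u v; exact: scalerDr. Qed.

Let scaleDl v : {morph scale^~ v : a b / a + b}.
Proof. by move=> a b; rewrite /scale rmorphD scalerDl. Qed.

HB.instance Definition _ := GRing.Zmodule_isLmodule.Build R (realification Y)
  scaleA scale1 scaleDr scaleDl.

Implicit Type u : realification Y -> R.

Definition real_norm (y : realification Y) : R := complex.Re `|y : Y|.

(** For real-linear [u], the complex-linear functional with real part [u]. *)
Definition complexify u (y : Y) : R[i]^o :=
  u y +i* - u ('i *: y : Y).

Lemma real_normE y : (real_norm y)%:C = `|y : Y|.
Proof. by rewrite RRe_real // normr_real. Qed.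

Lemma complexify_linear u : linear_functional u -> linear (complexify u).
Proof.
move=> ul a x y.
have scaleE (z : Y) : a *: z =
    (complex.Re a *: (z : realification Y) : realification Y) +
    (complex.Im a *: ('i *: z : realification Y) : realification Y) :> Y.
  by rewrite [a in LHS]complexE scalerDl mulrC -scalerA.
have u1 : u (a *: x + y : Y) =
    complex.Re a * u x + complex.Im a * u ('i *: x : Y) + u y.
  by rewrite scaleE -addrA ul ul addrA.
have u2 : u ('i *: (a *: x + y) : Y) =
    complex.Re a * u ('i *: x : Y) - complex.Im a * u x + u ('i *: y : Y).
  rewrite scalerDr scalerA mulrC -scalerA scaleE -addrA ul ul.
  by rewrite scalerA -expr2 sqr_i scaleN1r functionalN // mulrN addrA.
apply/eqP; rewrite /complexify u1 u2 eq_complex;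
  case: a {scaleE u1 u2} => a1 a2 /=.
by apply/andP; split; apply/eqP; ring.
Qed.

(** Multiplying [y] by a phase makes the value a nonnegative real, hence equal to its real part
    [u z]. Bounds on [u] over a ball thus carry over to the complex functional. *)
Lemma complexify_norm u y : linear_functional u ->
  exists2 z, real_norm z <= real_norm y & `|complexify u y| = (u z)%:C.
Proof.
move=> /complexify_linear ul; have [c c1 cu] := phaseP (complexify u y).
exists (c *: (y : Y)).
  by rewrite -lecR !real_normE normrZ ler_piMl.
have ucy : complexify u (c *: (y : Y)) = `|complexify u y|.
  rewrite -cu; have := ul c y 0; rewrite addr0 => ->.
  suff -> : complexify u 0 = 0 by rewrite addr0.
  by have := ul (-1) 0 0; rewrite scaler0 addr0 scaleN1r addNr.
by rewrite -[LHS]RRe_real ?normr_real // -ucy.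
Qed.

Lemma complexify_dual u : bounded_functional real_norm u ->
  dual (complexify u : Y -> R[i]^o).
Proof.
move=> [ul [C uC]]; split; first exact: complexify_linear.
exists `|C|%:C => y; have [z zy ->] := complexify_norm y ul.
rewrite -(real_normE y) -rmorphM lecR; apply: le_trans (uC z) _.
apply: le_trans (ler_wpM2r _ (ler_norm C)) (ler_wpM2l _ zy) => //.
by rewrite -ler0c real_normE.
Qed.

Lemma complexify_Re (f : Y -> R[i]^o) : linear f ->
  complexify (fun y => complex.Re (f y)) = f.
Proof.
move=> fl; apply/funext => y; rewrite /complexify.
have -> : f ('i *: (y : Y)) = 'i * f y.
  have f0 : f 0 = 0 by have := fl (-1) 0 0;
    rewrite scaler0 addr0 scaleN1r addNr.
  by rewrite -['i *: y]addr0 fl f0 addr0.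
by rewrite mulrC ReiNIm opprK; case: (f y).
Qed.

Lemma Re_le_norm (z : R[i]) : complex.Re z <= complex.Re `|z|.
Proof.
apply: le_trans (ler_norm _) _; rewrite -lecR (RRe_real (normr_real z)).
exact: normc_ge_Re.
Qed.

Lemma ReM_real (a : R) (z : R[i]) : complex.Re (a%:C * z) = a * complex.Re z.
Proof. by case: z => x y /=; rewrite mul0r subr0. Qed.

Lemma real_norm_sublinear : sublinear real_norm.
Proof.
split=> [x y|a x a0]; first by rewrite -lecR rmorphD /= !real_normE;
  exact: ler_normD.
apply: complexI; rewrite rmorphM /= !real_normE -[a%:C]ger0_norm ?ler0c //.
exact: normrZ.
Qed.

Lemma real_normN y : real_norm (- y) = real_norm y.
Proof. by apply: complexI; rewrite !real_normE normrN. Qed.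

End Realification.

Lemma complex_not_CPPm (R : realType) (Y : completeNormedModType R[i]) :
  ~ reflexive_space Y -> ~ CPPm (scalar_sum Y) (scalar_sum Y).
Proof.
move=> /existsNP[phi /not_implyP[phi_bidual phi_not_point]].
pose E := realification Y.
(* The real functional on the real dual that corresponds to [phi]. *)
pose psi (u : E -> R) := complex.Re (phi (complexify u)).
have [|||||F [s [F_lin s0 Fs Fsup]]] :=
  @james_sup R E real_norm real_norm_sublinear real_normN _ _ psi.
- move=> x /(congr1 (fun r => r%:C)); rewrite real_normE.
  exact: normr0_eq0.
- move=> s s_close.
  have [|x sx] := @cauchy_seq_converges _ Y s.
    move=> e e0; have [r er] : exists r : R, e = r%:C.
      by apply/complex_realP; exact: gtr0_real.
    rewrite er ltcR in e0; have r2 : 0 < r / 2 by rewrite divr_gt0.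
    have [N _ NP] := near_infty_natSinv_lt (PosNum r2).
    exists N => n Nn; rewrite er -real_normE ltcR.
    apply: le_lt_trans (s_close N n) _.
    have := NP N (leqnn N); have := NP n Nn => /=.
    by move: (n.+1%:R^-1) (N.+1%:R^-1) => ? ?; lra.
  exists x => e e0; have [|N _ NP] := sx e%:C; first by rewrite ltcR.
  by exists N => // n /= /NP; rewrite -real_normE lecR.
- move=> a b u v /complexify_dual ud /complexify_dual vd.
  rewrite /psi -!ReM_real -raddfD -(bidual_lincomb phi_bidual _ _ ud vd);
  congr (complex.Re (phi _)).
  apply/funext => y; apply/eqP; rewrite eq_complex /=.
  by apply/andP; split; apply/eqP; ring.
- have [C phiC] := bidual_bounded phi_bidual;
  exists (complex.Re C) => u [ul up].
  have ud : bounded_functional real_norm u by split=> //; exists 1 => y;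
    rewrite mul1r.
  apply: le_trans (Re_le_norm _) _.
  have : `|phi (complexify u)| <= C.
    apply: phiC; first exact: complexify_dual.
    move=> y; have [z zy ->] := complexify_norm y ul.
    by rewrite -(real_normE y) lecR; exact: le_trans zy.
  by rewrite lecE => /andP[].
- move=> [x xP]; apply: phi_not_point; exists x.
  have ReP f : dual f -> complex.Re (phi f) = complex.Re (f x).
    move=> [fl [C fC]]; rewrite -(complexify_Re fl); apply: xP.
    split.
      move=> a y z; have := fl a%:C y z; rewrite /GRing.scale /= => ->.
      by rewrite raddfD /= ReM_real.
    exists (complex.Re C) => y; apply: le_trans (Re_le_norm _) _.
    have := fC y; rewrite lecE => /andP[_ /le_trans]; apply.
    by rewrite -(real_normE y) mulrC ReM_real mulrC.
  (* The real part of [- 'i * f] is the imaginary part of [f], so [ReP] for both functionals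
     determines [phi f]. *)
  move=> f fd; have ifd := dual_lincomb (- 'i) 0 fd fd.
  have := ReP _ ifd; rewrite bidual_lincomb // !mul0r !addr0 => Im_eq.
  have Re_eq := ReP _ fd.
  move: Im_eq Re_eq; case: (phi f) => a b; case: (f x) => c d /=.
  by rewrite !oppr0 !mul0r !mulN1r !sub0r !opprK => -> ->.
apply: (@shear_not_CPPm R[i] Y (complexify F) s%:C).
- exact: complexify_linear.
- by rewrite ltcR.
- move=> y y1; have [z zy ->] := complexify_norm y F_lin.
  by rewrite ltcR; apply: Fs; apply: le_trans zy _; rewrite -lecR real_normE.
(* Being comparable to the real [s], the scalar [t] is real. *)
- move=> t ts; have [r tr] : exists r : R, t = r%:C.
    apply/complex_realP; rewrite (ler_real (ltW ts)); apply/complex_realP.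
    by exists s.
  rewrite tr ltcR in ts *; have [y y1 ty] := Fsup r ts.
  exists y; first by rewrite -real_normE lecR.
  apply: lt_le_trans (_ : (F y)%:C <= _); first by rewrite ltcR.
  rewrite -(RRe_real (normr_real (complexify F y))) lecR.
  exact: (Re_le_norm (complexify F y)).
- exact: complex_box_compact.
Qed.

Theorem theorem2p1 (R : realType) :
  (forall Y : completeNormedModType R,
     ~ reflexive_space Y -> ~ CPPm (scalar_sum Y) (scalar_sum Y)) /\
  (forall Y : completeNormedModType R[i],
     ~ reflexive_space Y -> ~ CPPm (scalar_sum Y) (scalar_sum Y)).
Proof. by split=> Y; [exact: real_not_CPPm|exact: complex_not_CPPm]. Qed.
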